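(* For $1 \leq i \leq n$, let $f_i : (0,\infty) \to \mathbb{R}_+$ be either all convex or all concave functions and let $\varphi_i : \mathbb{R}^n \to [0,\infty)$ be log concave functions. Then, for $1 \leq m \leq n-1$, $$\left[ D_{\vec f}\left(P_{\vec\varphi}, Q_{\vec\varphi}\right)\right]^m \leq \prod_{k=n-m+1}^{n} D_{\vec f_{m,k}}\left(P_{\vec\varphi_{m,k}}, Q_{\vec\varphi_{m,k}}\right).$$ Equality holds if and only if one of the functions $h_0^{1/m} h_j$, $1 \leq j \leq m$, is null or all of them are effectively proportional. If $m = n$, then $$\left[ D_{\vec f}\left(P_{\vec\varphi}, Q_{\vec\varphi}\right)\right]^n \leq \prod_{k=1}^{n} D_{f_k}\left(P_{\varphi_k}, Q_{\varphi_k}\right).$$ Equality holds if and only if one of the functions $h_j$, $1 \leq j \leq n$, is null or all of them are effectively proportional.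
   Context: $\mathbb{R}_+ = [0,\infty)$. A function $\varphi : \mathbb{R}^n \to [0,\infty)$ is log concave if $\varphi = e^{-\psi}$ with $\psi : \mathbb{R}^n \to \mathbb{R}$ convex. Its dual function is $\varphi^\circ(y) = \inf_{x\in\mathbb{R}^n} e^{-\langle x,y\rangle}/\varphi(x)$. For a log concave $\varphi$ put $$\Theta_\varphi(x) = \frac{e^{\langle \nabla\varphi(x),x\rangle/\varphi(x)}}{\varphi(x)^2}\,\det\left[\mathrm{Hess}(-\log\varphi)(x)\right].$$ The dimension $n$ is also the number of functions. For vectors $\vec f=(f_1,\dots,f_n)$ and $\vec\varphi=(\varphi_1,\dots,\varphi_n)$ the mixed $f$-divergence is $$D_{\vec f}(P_{\vec\varphi},Q_{\vec\varphi}) = \int_{\mathbb{R}^n} \prod_{i=1}^n \left[\varphi_i\, f_i(\Theta_{\varphi_i})\right]^{1/n} dx,$$ and for a single $f$ and $\varphi$, $D_f(P_\varphi,Q_\varphi)=\int_{\mathbb{R}^n} \varphi\, f(\Theta_\varphi)\,dx$. For $1\leq m\leq n-1$ and $k>n-m$, $D_{\vec f_{m,k}}(P_{\vec\varphi_{m,k}},Q_{\vec\varphi_{m,k}})$ denotes the mixed $f$-divergence of the $n$-vectors $\vec f_{m,k} = (f_1,\dots,f_{n-m},f_k,\dots,f_k)$ and $\vec\varphi_{m,k} = (\varphi_1,\dots,\varphi_{n-m},\varphi_k,\dots,\varphi_k)$, where $f_k$, $\varphi_k$ are repeated $m$ times. Put $h_0 = \prod_{i=1}^{n-m}\left[\varphi_i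 f_i(\Theta_{\varphi_i})\right]^{1/n}$ and, for $j=0,\dots,m-1$, $h_{j+1} = \left[\varphi_{n-j} f_{n-j}(\Theta_{\varphi_{n-j}})\right]^{1/n}$ (for $m=n$ only $h_1,\dots,h_n$ are used). Two functions $f,g$ are effectively proportional if there are constants $a,b$, not both zero, with $af=bg$; several functions are effectively proportional if every pair is. A null function (zero almost everywhere) is effectively proportional to any function; equalities of functions are understood almost everywhere. Standing assumptions: all $\varphi_i$ and $\varphi_i^\circ$ are in $C^2\cap L^1(\mathbb{R}^n,dx)$, and the functions are regular and integrable enough that the expressions in the statement make sense; in particular the integrands of the occurring divergences are in $L^1(\mathbb{R}^n,dx)$. *)

(* Defs.v *)
From HB Require Import structures.
From mathcomp Require Import all_boot all_order all_algebra.
From mathcomp Require Import all_classical all_reals all_analysis.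

Set Implicit Arguments.
Unset Strict Implicit.
Unset Printing Implicit Defensive.

Import Order.TTheory GRing.Theory Num.Theory.
Import numFieldNormedType.Exports.

Local Open Scope classical_set_scope.
Local Open Scope ring_scope.

(* R^n is the space of row vectors, with the product sigma-algebra, i.e. the   *)
(* sigma-algebra generated by the n coordinate functions.                      *)
Fact rV_display : measure_display. Proof. exact: default_measure_display. Qed.

Section measurable_rV.
Context {R : realType} {n : nat}.

Let coord (i : 'I_n) (x : 'rV[R]_n) : measurableTypeR R := x ord0 i.

Let rV_set0 : g_sigma_preimage coord set0.
Proof. exact: sigma_algebra0. Qed.

Let rV_setC A : g_sigma_preimage coord A -> g_sigma_preimage coord (~` A).
Proof. exact: sigma_algebraC. Qed.

Let rV_bigcup (F : _^nat) : (forall i, g_sigma_preimage coord (F i)) ->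
  g_sigma_preimage coord (\bigcup_i (F i)).
Proof. exact: sigma_algebra_bigcup. Qed.

HB.instance Definition _ := @isMeasurable.Build rV_display
  'rV[R]_n (g_sigma_preimage coord) rV_set0 rV_setC rV_bigcup.

Lemma measurable_coord (i : 'I_n) :
  measurable_fun setT (fun x : 'rV[R]_n => x ord0 i : measurableTypeR R).
Proof.
move=> _ Y mY; rewrite setTI; apply: sub_sigma_algebra => /=.
rewrite -bigcup_seq/=; exists i => /=; first by rewrite mem_index_enum.
by exists Y => //; rewrite setTI.
Qed.

Lemma measurable_fun_rVP d (T : measurableType d) (g : T -> 'rV[R]_n) :
  (forall i, measurable_fun setT (fun t => g t ord0 i : measurableTypeR R)) ->
  measurable_fun setT g.
Proof.
move=> mg _ A mA; rewrite setTI.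
suff : <<s \big[setU/set0]_(i < n)
    preimage_set_system setT (coord i) measurable >> `<=`
    [set A | measurable (g @^-1` A)] by apply.
apply: smallest_sub.
  split => /=; first by rewrite preimage_set0.
    by move=> B mB; rewrite setTD preimage_setC; exact: measurableC.
  by move=> F mF; rewrite preimage_bigcup; exact: bigcup_measurable.
move=> B; rewrite -bigcup_seq => -[i _ [C mC <-]] /=.
by have := mg i measurableT C mC; rewrite !setTI.
Qed.

End measurable_rV.

Section lebesgue_rV.
Context {R : realType}.
Local Open Scope ereal_scope.

Definition consrV n (p : measurableTypeR R * 'rV[R]_n) : 'rV[R]_n.+1 :=
  row_mx (p.1 : R)%:M p.2 : 'rV[R]_(1 + n).

Lemma consrV0 n p : @consrV n p ord0 ord0 = p.1.
Proof.
have -> : ord0 = lshift n (ord0 : 'I_1) by exact/val_inj.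
by rewrite (@row_mxEl R 1 1 n) mxE eqxx.
Qed.

Lemma consrVS n p i : @consrV n p ord0 (lift ord0 i) = p.2 ord0 i.
Proof.
have -> : lift ord0 i = rshift 1 i by exact/val_inj.
by rewrite (@row_mxEr R 1 1 n).
Qed.

Lemma measurable_consrV n : measurable_fun setT (@consrV n).
Proof.
apply: measurable_fun_rVP => i; case: (unliftP ord0 i) => [j|] ->.
  under eq_fun do rewrite consrVS.
  exact: (measurableT_comp (measurable_coord j) measurable_snd).
under eq_fun do rewrite consrV0.
exact: measurable_fst.
Qed.

Definition unconsrV n (x : 'rV[R]_n.+1) : measurableTypeR R * 'rV[R]_n :=
  (x ord0 ord0, \row_i x ord0 (lift ord0 i)).

Lemma consrVK n : cancel (@consrV n) (@unconsrV n).
Proof.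
move=> [a v]; rewrite /unconsrV consrV0; congr pair.
by apply/rowP => i; rewrite mxE consrVS.
Qed.

Lemma measurable_unconsrV n : measurable_fun setT (@unconsrV n).
Proof.
apply: measurable_fun_pair; first exact: measurable_coord.
apply: measurable_fun_rVP => i.
under eq_fun do rewrite mxE.
exact: measurable_coord.
Qed.

Section step.
Variables (n : nat) (mu : {sigma_finite_measure set 'rV[R]_n -> \bar R}).

Definition lebesgue_step : set 'rV[R]_n.+1 -> \bar R :=
  pushforward (@lebesgue_measure R \x mu) (@consrV n).

Let measurable_pre A : measurable A -> measurable (@consrV n @^-1` A).
Proof.
by move=> mA; rewrite -[X in measurable X]setTI; exact: measurable_consrV.
Qed.

Let step0 : lebesgue_step set0 = 0.
Proof. by rewrite /lebesgue_step /pushforward preimage_set0 measure0. Qed.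

Let step_ge0 A : 0 <= lebesgue_step A.
Proof. by rewrite /lebesgue_step /pushforward; apply: measure_ge0. Qed.

Let step_sigma_additive : semi_sigma_additive lebesgue_step.
Proof.
move=> F mF tF mUF; rewrite /lebesgue_step /pushforward preimage_bigcup.
apply: measure_semi_sigma_additive => [i||].
- exact: measurable_pre.
- apply/trivIsetP => /= i j _ _ ij; rewrite -preimage_setI.
  by move/trivIsetP : tF => /(_ _ _ _ _ ij) ->//; rewrite preimage_set0.
- by rewrite -preimage_bigcup; exact: measurable_pre.
Qed.

HB.instance Definition _ := isMeasure.Build _ _ _ lebesgue_step
  step0 step_ge0 step_sigma_additive.

Let step_sigma_finite : sigma_finite setT lebesgue_step.
Proof.
have /sigma_finiteP[F [TF ndF Foo]] := sigma_finiteT (@lebesgue_measure R).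
have /sigma_finiteP[H [TH ndH Hoo]] := sigma_finiteT mu.
pose G i := F i `*` H i.
have TG : setT = \bigcup_i G i.
  rewrite -setXTT TF TH predeqE => -[x y]; split.
    move=> [/= [i _ Fx] [k _ Hy]]; exists (maxn i k) => //; split.
    - by move: x Fx; exact/subsetPset/ndF/leq_maxl.
    - by move: y Hy; exact/subsetPset/ndH/leq_maxr.
  by move=> [i _ []/= ? ?]; split; exists i.
have Goo i : measurable (G i) /\ (@lebesgue_measure R \x mu) (G i) < +oo.
  have [? ?] := Foo i; have [? ?] := Hoo i.
  split; first exact: measurableX.
  by rewrite product_measure1E// lte_mul_pinfty// ge0_fin_numE.
have GK i : @consrV n @^-1` (@unconsrV n @^-1` G i) = G i.
  by apply/seteqP; split => p /=; rewrite consrVK.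
exists (fun i => @unconsrV n @^-1` G i).
  by rewrite -preimage_bigcup -TG preimage_setT.
move=> i; have [mG Goo'] := Goo i; split.
  by rewrite -[X in measurable X]setTI; exact: measurable_unconsrV.
by rewrite /lebesgue_step /pushforward GK.
Qed.

HB.instance Definition _ := Measure_isSigmaFinite.Build _ _ _ lebesgue_step
  step_sigma_finite.

End step.

Fixpoint lebesgue_rV n : {sigma_finite_measure set 'rV[R]_n -> \bar R} :=
  match n with
  | 0%N => [the {sigma_finite_measure set 'rV[R]_0 -> \bar R} of @dirac _ 'rV[R]_0 (0%R : 'rV[R]_0) R]
  | n'.+1 => [the {sigma_finite_measure set 'rV[R]_n'.+1 -> \bar R} of
               lebesgue_step (lebesgue_rV n')]
  end.

Lemma lebesgue_rV_box n (A : 'I_n -> set (measurableTypeR R)) :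
  (forall i, measurable (A i)) ->
  lebesgue_rV n [set x : 'rV[R]_n | forall i, A i (x ord0 i)] =
  \prod_(i < n) lebesgue_measure (A i).
Proof.
elim: n A => [|n IHn] A mA.
  rewrite big_ord0 /= diracE mem_set// => -[].
  by [].
rewrite big_ord_recl -IHn//= /lebesgue_step /pushforward.
rewrite -product_measure1E//.
  congr (_ _); apply/seteqP; split => p /=.
    by move=> h; split => [|i]; [have := h ord0; rewrite consrV0|
                                 have := h (lift ord0 i); rewrite consrVS].
  move=> [p1 p2] i; case: (unliftP ord0 i) => [j|] ->.
    by rewrite consrVS.
  by rewrite consrV0.
have -> : [set x : 'rV[R]_n | forall i, A (lift ord0 i) (x ord0 i)] =
    \bigcap_(i in [set: 'I_n]) ((fun x : 'rV[R]_n => x ord0 i) @^-1` A (lift ord0 i)).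
  by apply/seteqP; split => x /= h i => [_|]; exact: h.
apply: fin_bigcap_measurable => // i _.
rewrite -[X in measurable X]setTI; exact: measurable_coord.
Qed.

End lebesgue_rV.

Section calculus.
Context {R : realType} {n : nat}.
Implicit Types (g phi psi : 'rV[R]_n -> R) (x y v : 'rV[R]_n).

Definition dotrV x y : R := \sum_(i < n) x ord0 i * y ord0 i.

Definition partial (i : 'I_n) g x : R := 'D_(delta_mx ord0 i) g x.

Definition grad g x : 'rV[R]_n := \row_i partial i g x.

Definition hess g x : 'M[R]_n := \matrix_(i, j) partial i (partial j g) x.

Definition C1 g :=
  continuous g /\
  forall i, (forall x, derivable g x (delta_mx ord0 i)) /\
            continuous (partial i g).

Definition C2 g := C1 g /\ forall i, C1 (partial i g).

Definition L1 g := (lebesgue_rV n).-integrable setT (EFin \o g).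

Definition log_concave phi :=
  exists2 psi, convex_function [set: 'rV[R]_n] psi &
    forall x, phi x = expR (- psi x).

Definition dual_fun phi y : R :=
  inf [set expR (- dotrV x y) / phi x | x in [set: 'rV[R]_n]].

Definition Theta phi x : R :=
  expR (dotrV (grad phi x) x / phi x) / phi x ^+ 2 *
  \det (hess (fun y => - ln (phi y)) x).

End calculus.

Section divergence.
Context {R : realType} {n : nat}.
Implicit Types (f : R -> R) (phi : 'rV[R]_n -> R).
Implicit Types (fs : 'I_n -> R -> R) (phis : 'I_n -> 'rV[R]_n -> R).

(* A function (0, +oo) -> R_+ is represented by a nonnegative function on R;   *)
(* its values on (-oo, 0] are arbitrary and only matter where the Hessian in   *)
(* Theta is degenerate.                                                        *)
Definition convex_pos f := convex_function (`]0, +oo[ : set R^o) f.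

Definition concave_pos f := convex_pos (fun t => - f t).

Definition div_integrand f phi x : R := phi x * f (Theta phi x).

Definition divergence f phi : R :=
  (\int[lebesgue_rV n]_x div_integrand f phi x)%R.

Definition mixed_integrand fs phis x : R :=
  \prod_(i < n) div_integrand (fs i) (phis i) x `^ n%:R^-1.

Definition mixed_divergence fs phis : R :=
  (\int[lebesgue_rV n]_x mixed_integrand fs phis x)%R.

(* (u_1, ..., u_(n-m), u_k, ..., u_k); since indices in 'I_n start at 0, the   *)
(* condition k > n - m on a 1-based index k reads n - m <= k.                  *)
Definition repeat_last (T : Type) (m : nat) (k : 'I_n) (u : 'I_n -> T) :
  'I_n -> T := fun i => if (i < n - m)%N then u i else u k.

Definition h_zero fs phis (m : nat) x : R :=
  \prod_(i < n | (i < n - m)%N) div_integrand (fs i) (phis i) x `^ n%:R^-1.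

(* h_succ fs phis j is h_(j+1), which involves the function of 1-based index   *)
(* n - j, that is, of 0-based index n - j - 1 = rev_ord j.                     *)
Definition h_succ fs phis (j : 'I_n) x : R :=
  div_integrand (fs (rev_ord j)) (phis (rev_ord j)) x `^ n%:R^-1.

Definition null_ae (g : 'rV[R]_n -> R) :=
  {ae lebesgue_rV n, forall x, g x = 0}.

Definition eff_proportional (g h : 'rV[R]_n -> R) :=
  exists a b : R, (a != 0 \/ b != 0) /\
    {ae lebesgue_rV n, forall x, a * g x = b * h x}.

End divergence.

(* Main.v *)
Require Import Defs.
From mathcomp Require Import all_boot all_order all_algebra.
From mathcomp Require Import all_classical all_reals all_analysis.
Import Order.TTheory GRing.Theory Num.Theory.
Import numFieldNormedType.Exports.
Local Open Scope classical_set_scope.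
Local Open Scope ring_scope.

(** The theorem is Hölder's inequality for [m] factors with all exponents equal
    to [m], together with its equality case. Put
    [g j := h_zero ^ (1/m) * h_succ j] for [j < m]. These functions are
    nonnegative, the mixed integrand is their product
    ([mixed_integrand_prod]), and [g j ^ m] is the integrand of the divergence
    in which the function of index [n - 1 - j] is repeated [m] times
    ([mixed_integrand_repeat_last]). So the inequality reads
    [(int prod_j g_j)^m <= prod_j int g_j^m]. For [m = n] the factors are the
    [h_succ j] themselves, and [h_succ j ^ n] is the integrand of a single
    divergence.

    Hölder's inequality follows from the inequality between arithmetic and
    geometric means. If no [g_j] is null, divide each [g_j] by the positive
    number [r_j] with [r_j^m = int g_j^m]; the quotients [w_j] satisfy
    [int w_j^m = 1], and integrating [prod_j w_j <= (1/m) sum_j w_j^m] gives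
    [int prod_j w_j <= 1] ([holder_normalized]). As the difference of the two
    sides is nonnegative, equality of the integrals means that the two sides
    agree almost everywhere, hence, by the equality case for means, that all
    [w_j] agree almost everywhere; this is effective proportionality of the
    [g_j] ([holder_prod]). *)

(** * Hölder's inequality for finitely many functions *)

Lemma Rintegral_eq0_ae d (T : measurableType d) (R : realType)
    (mu : {measure set T -> \bar R}) (h : T -> R) :
  (forall x, 0 <= h x) -> mu.-integrable setT (EFin \o h) ->
  (\int[mu]_x h x)%R = 0 <-> {ae mu, forall x, h x = 0}.
Proof.
move=> h0 ih.
have absE : (\int[mu]_x `|(EFin \o h) x|)%E = (\int[mu]_x h x)%:E.
  rewrite /Rintegral fineK; last exact: integrable_fin_num.
  by apply: eq_integral => x _ /=; rewrite ger0_norm.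
have [mh _] := integrableP _ _ _ ih.
have := ae_eq_integral_abs mu measurableT mh; rewrite absE => -[int0 ae0].
split=> [h_0|h_0].
  have /int0 : (\int[mu]_x h x)%R%:E = 0%E by rewrite h_0.
  by apply: filterS => x /(_ I) /= [].
by apply: EFin_inj; apply: ae0; apply: filterS h_0 => x /= ->.
Qed.

Lemma Rintegral_sum d (T : measurableType d) (R : realType)
    (mu : {measure set T -> \bar R}) (I : Type) (s : seq I) (P : pred I)
    (F : I -> T -> R) :
  (forall i, P i -> mu.-integrable setT (EFin \o F i)) ->
  mu.-integrable setT (EFin \o (fun x => \sum_(i <- s | P i) F i x)) /\
  (\int[mu]_x \sum_(i <- s | P i) F i x)%R =
    \sum_(i <- s | P i) (\int[mu]_x F i x)%R.
Proof.
move=> iF; elim: s => [|i s [IHi IHs]].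
  under eq_fun do rewrite big_nil.
  split; first exact: integrable0.
  by rewrite big_nil Rintegral_cst// mul0r.
under eq_fun do rewrite big_cons.
rewrite big_cons; case: ifP => // Pi; split.
  exact: (integrableD measurableT (iF _ Pi) IHi).
by rewrite RintegralD// ?IHs//; exact: iF.
Qed.

(** The defect [M - G] between the arithmetic and the geometric mean is
    nonnegative with integral [1 - int prod w]: its sign gives the inequality,
    and its vanishing almost everywhere the equality case. *)
Lemma holder_normalized d (T : measurableType d) (R : realType)
    (mu : {measure set T -> \bar R}) (I : finType) (A : {pred I})
    (w : I -> T -> R) :
  (0 < #|A|)%N -> (forall i x, 0 <= w i x) ->
  (forall i, i \in A ->
    mu.-integrable setT (EFin \o (fun x => w i x ^+ #|A|))) ->
  (forall i, i \in A -> (\int[mu]_x w i x ^+ #|A|)%R = 1) ->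
  mu.-integrable setT (EFin \o (fun x => \prod_(i in A) w i x)) ->
  (\int[mu]_x \prod_(i in A) w i x)%R <= 1 /\
  ((\int[mu]_x \prod_(i in A) w i x)%R = 1 <->
   forall i j, i \in A -> j \in A -> {ae mu, forall x, w i x = w j x}).
Proof.
set m := #|A| => m0 w0 iw w1 iG.
pose M x := m%:R^-1 * \sum_(i in A) w i x ^+ m.
pose G x := \prod_(i in A) w i x.
have [iS S1] := @Rintegral_sum _ _ _ mu _ (index_enum I) (mem A) _ iw.
have iM : mu.-integrable setT (EFin \o M).
  exact: (integrableZl measurableT m%:R^-1 iS).
have M1 : (\int[mu]_x M x)%R = 1.
  rewrite RintegralZl// S1 (eq_bigr (fun=> 1)); last exact: w1.
  by rewrite sumr_const mulVf// pnatr_eq0 -lt0n.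
have G0 x : 0 <= G x by apply: prodr_ge0.
have M0 x : 0 <= M x.
  by rewrite mulr_ge0 ?invr_ge0 ?ler0n// sumr_ge0// => i _; exact: exprn_ge0.
have AGM x : G x <= M x ?= iff [forall i in A, forall j in A, w i x == w j x].
  have := @leif_AGM _ _ A (fun i => w i x ^+ m)
    (fun i _ => exprn_ge0 _ (w0 i x)).
  rewrite -/m prodrXl mulrC -/(M x) -/(G x) => -[le_ eq_]; split.
    by rewrite -(@ler_pXn2r _ m)// nnegrE.
  rewrite -(@eqrXn2 _ m)// eq_.
  apply: eq_forallb_in => i _; apply: eq_forallb_in => j _.
  by rewrite eqrXn2.
have iH : mu.-integrable setT (EFin \o (fun x => M x - G x)).
  exact: (integrableB measurableT iM iG).
have H1 : (\int[mu]_x (M x - G x))%R = 1 - (\int[mu]_x G x)%R.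
  by rewrite RintegralB// M1.
have H0 x : 0 <= M x - G x by rewrite subr_ge0 (AGM x).
split; first by rewrite -subr_ge0 -H1; apply: Rintegral_ge0.
have [int_ae ae_int] := @Rintegral_eq0_ae _ _ _ mu _ H0 iH.
split=> [eq1 i j iA jA|prop].
  have /int_ae : (\int[mu]_x (M x - G x))%R = 0 by rewrite H1 /G eq1 subrr.
  apply: filterS => x /eqP; rewrite subr_eq0 eq_sym (AGM x).
  by move=> /forall_inP/(_ _ iA)/forall_inP/(_ _ jA)/eqP.
suff /ae_int : {ae mu, forall x, M x - G x = 0}.
  by rewrite H1 => /eqP; rewrite subr_eq0 eq_sym => /eqP.
have : {ae mu, forall x, forall i j, i \in A -> j \in A -> w i x = w j x}.
  apply: filter_forall => i; apply: filter_forall => j.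
  have [iA|iA] := boolP (i \in A); last by apply: nearW => x /negP.
  have [jA|jA] := boolP (j \in A); last by apply: nearW => x _ /negP.
  by apply: filterS (prop i j iA jA) => x.
apply: filterS => x wx; apply/eqP; rewrite subr_eq0 eq_sym (AGM x).
by apply/forall_inP => i iA; apply/forall_inP => j jA; apply/eqP/wx.
Qed.

(** The two ways to have equality are of different nature: a null factor makes
    both sides zero, whatever the other factors are; otherwise all norms are
    positive and the factors can be normalized, which reduces the claim to
    [holder_normalized]. *)
Lemma holder_prod d (T : measurableType d) (R : realType)
    (mu : {measure set T -> \bar R}) (I : finType) (A : {pred I})
    (g : I -> T -> R) :
  (0 < #|A|)%N -> (forall i x, 0 <= g i x) ->
  (forall i, i \in A ->
    mu.-integrable setT (EFin \o (fun x => g i x ^+ #|A|))) ->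
  mu.-integrable setT (EFin \o (fun x => \prod_(i in A) g i x)) ->
  (\int[mu]_x \prod_(i in A) g i x)%R ^+ #|A| <=
    \prod_(i in A) (\int[mu]_x g i x ^+ #|A|)%R /\
  ((\int[mu]_x \prod_(i in A) g i x)%R ^+ #|A| =
    \prod_(i in A) (\int[mu]_x g i x ^+ #|A|)%R <->
   (exists i, i \in A /\ {ae mu, forall x, g i x = 0}) \/
   (forall i j, i \in A -> j \in A ->
      exists a b : R, (a != 0 \/ b != 0) /\
        {ae mu, forall x, a * g i x = b * g j x})).
Proof.
set m := #|A| => m0 g0 ig iG.
have pow_null i x : (g i x ^+ m = 0) <-> g i x = 0.
  by split=> [/eqP|->]; rewrite ?expf_eq0 ?expr0n ?m0 ?(gtn_eqF m0)//= => /eqP.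
have c_ge0 i : 0 <= (\int[mu]_x g i x ^+ m)%R.
  by apply: Rintegral_ge0 => x _; exact: exprn_ge0.
have null_c i : i \in A -> (\int[mu]_x g i x ^+ m)%R = 0 <->
    {ae mu, forall x, g i x = 0}.
  move=> iA; rewrite Rintegral_eq0_ae; last exact: ig; last first.
    by move=> x; exact: exprn_ge0.
  by split; apply: filterS => x /pow_null.
have [[i [iA i0]]|nnull] :=
    pselect (exists i, i \in A /\ {ae mu, forall x, g i x = 0}).
  have -> : (\int[mu]_x \prod_(i in A) g i x)%R = 0.
    apply/Rintegral_eq0_ae => //; first by move=> x; exact: prodr_ge0.
    by apply: filterS i0 => x gx; rewrite (bigD1 i)//= gx mul0r.
  have -> : \prod_(i in A) (\int[mu]_x g i x ^+ m)%R = 0.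
    by rewrite (bigD1 i)//= (null_c i iA).2// mul0r.
  by rewrite expr0n (gtn_eqF m0); split=> //; split=> // _; left; exists i.
have c_gt0 i : i \in A -> 0 < (\int[mu]_x g i x ^+ m)%R.
  move=> iA; rewrite lt0r c_ge0 andbT; apply/eqP => /(null_c i iA) i0.
  by apply: nnull; exists i.
(* the norm of g i in the Lebesgue space of exponent m *)
pose r i := (\int[mu]_x g i x ^+ m)%R `^ m%:R^-1.
have mN0 : m%:R != 0 :> R by rewrite pnatr_eq0 -lt0n.
have rm i : r i ^+ m = (\int[mu]_x g i x ^+ m)%R.
  by rewrite -powR_mulrn ?powR_ge0// -powRrM mulVf// powRr1.
have r_gt0 i : i \in A -> 0 < r i by move=> iA; rewrite powR_gt0// c_gt0.
pose w i x := (r i)^-1 * g i x.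
have w0 i x : 0 <= w i x by rewrite mulr_ge0// invr_ge0 powR_ge0.
have wm i x : w i x ^+ m = (r i ^+ m)^-1 * g i x ^+ m by rewrite exprMn exprVn.
have iw i : i \in A -> mu.-integrable setT (EFin \o (fun x => w i x ^+ m)).
  move=> iA; under eq_fun do rewrite wm.
  exact: (integrableZl measurableT _ (ig i iA)).
have w1 i : i \in A -> (\int[mu]_x w i x ^+ m)%R = 1.
  move=> iA; under eq_Rintegral do rewrite wm.
  rewrite RintegralZl//; last exact: ig.
  by rewrite rm mulVf// gt_eqF// c_gt0.
pose c := \prod_(i in A) r i.
have c0 : 0 < c by apply: prodr_gt0.
have wE x : \prod_(i in A) w i x = c^-1 * \prod_(i in A) g i x.
  by rewrite big_split/= prodfV.
have iW : mu.-integrable setT (EFin \o (fun x => \prod_(i in A) w i x)).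
  under eq_fun do rewrite wE.
  exact: (integrableZl measurableT _ iG).
have intW : (\int[mu]_x \prod_(i in A) w i x)%R =
    c^-1 * (\int[mu]_x \prod_(i in A) g i x)%R.
  by under eq_Rintegral do rewrite wE; rewrite RintegralZl.
have cm : \prod_(i in A) (\int[mu]_x g i x ^+ m)%R = c ^+ m.
  by rewrite -prodrXl; apply: eq_bigr => i _; rewrite rm.
have G0 : 0 <= (\int[mu]_x \prod_(i in A) g i x)%R.
  by apply: Rintegral_ge0 => x _; exact: prodr_ge0.
have [le1 eq1] := @holder_normalized _ _ _ mu _ A w m0 w0 iw w1 iW.
rewrite cm; split.
  rewrite ler_pXn2r ?nnegrE// ?(ltW c0)//.
  by move: le1; rewrite intW mulrC ler_pdivrMr// mul1r.
have -> : (\int[mu]_x \prod_(i in A) g i x)%R ^+ m = c ^+ m <->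
    (\int[mu]_x \prod_(i in A) w i x)%R = 1.
  rewrite intW; split=> [/eqP|].
    by rewrite eqrXn2 ?(ltW c0)// => /eqP ->; rewrite mulVf ?gt_eqF.
  by move=> /(congr1 ( *%R c)); rewrite mulr1 mulVKf ?gt_eqF// => ->.
rewrite eq1; split=> [eqw|[//|prop] i j iA jA].
  right=> i j iA jA; exists (r i)^-1, (r j)^-1; split; last exact: eqw.
  by left; rewrite invr_eq0 gt_eqF ?r_gt0.
have [a [b [ab abE]]] := prop i j iA jA.
(* if a vanished, then b would not, and g j would be null *)
have a0 : a != 0.
  apply/eqP => a0; case: ab => [|b0]; first by rewrite a0 eqxx.
  apply: nnull; exists j; split=> //; apply: filterS abE => x /eqP.
  by rewrite a0 mul0r eq_sym mulf_eq0 (negbTE b0) => /eqP.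
(* as the functions are nonnegative, the ratio can be replaced by its
   absolute value, which makes the norms proportional with the same ratio *)
have gE : {ae mu, forall x, g i x = `|b / a| * g j x}.
  apply: filterS abE => x abx.
  rewrite -[g i x]ger0_norm// -[g j x]ger0_norm// -normrM.
  by rewrite mulrAC -abx mulrAC divff ?mul1r.
have rE : r i = `|b / a| * r j.
  apply/eqP; rewrite -(@eqrXn2 _ m) ?mulr_ge0 ?(ltW (r_gt0 _ _))//.
  rewrite exprMn (rm i) (rm j) -(RintegralZl _ measurableT (ig j jA)).
  apply/eqP; congr fine; apply: ae_eq_integral => //.
  - by have /integrableP[] := ig i iA.
  - by have /integrableP[] :=
      integrableZl measurableT (`|b / a| ^+ m) (ig j jA).
  - by apply: filterS gE => x gx _ /=; rewrite gx exprMn.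
have t0 : `|b / a| != 0.
  by apply/eqP => t0; have := r_gt0 i iA; rewrite rE t0 mul0r ltxx.
apply: filterS gE => x gx.
by rewrite /w gx rE invfM mulrACA mulVf// mul1r.
Qed.

(** * The mixed integrand as a product of Hölder factors *)

Lemma div_integrand_ge0 (R : realType) (n : nat) (f : R -> R)
    (phi : 'rV[R]_n -> R) x :
  (forall t, 0 <= f t) -> log_concave phi -> 0 <= div_integrand f phi x.
Proof.
move=> f0 [psi _ phiE]; rewrite mulr_ge0// phiE; exact: expR_ge0.
Qed.

Lemma prod_rev_ord (R : realType) (n m : nat) (F : 'I_n -> R) : (m <= n)%N ->
  \prod_(k < n | (n - m <= k)%N) F k =
  \prod_(j in [pred j : 'I_n | (j < m)%N]) F (rev_ord j).
Proof.
move=> mn; rewrite (reindex_inj rev_ord_inj)/=; apply: eq_bigl => j.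
by rewrite inE leq_sub2lE.
Qed.

Lemma card_ord_lt (n m : nat) : (m <= n)%N ->
  #|[pred j : 'I_n | (j < m)%N]| = m.
Proof.
by move=> mn; rewrite -sum1_card -(big_ord_widen _ (fun=> 1%N) mn) sum1_card
  card_ord.
Qed.

Lemma powR_invK (R : realType) (m : nat) (a : R) :
  (0 < m)%N -> 0 <= a -> (a `^ m%:R^-1) ^+ m = a.
Proof.
move=> m0 a0.
by rewrite -powR_mulrn ?powR_ge0// -powRrM mulVf ?powRr1// pnatr_eq0 -lt0n.
Qed.

Lemma prod_split_last (R : realType) (n m : nat) (u : 'I_n -> R) :
  (m <= n)%N ->
  \prod_(i < n) u i = \prod_(i < n | (i < n - m)%N) u i *
    \prod_(j in [pred j : 'I_n | (j < m)%N]) u (rev_ord j).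
Proof.
move=> mn; rewrite (bigID (fun i : 'I_n => (i < n - m)%N))/=; congr (_ * _).
by rewrite -prod_rev_ord//; apply: eq_bigl => i; rewrite -leqNgt.
Qed.

Lemma prod_repeat_last (R : realType) (n m : nat) (u : 'I_n -> R) (c : R) :
  (m <= n)%N ->
  \prod_(i < n) (if (i < n - m)%N then u i else c) =
    \prod_(i < n | (i < n - m)%N) u i * c ^+ m.
Proof.
move=> mn; rewrite (prod_split_last _ _ _ _ mn); congr (_ * _).
  by apply: eq_bigr => i ->.
rewrite (eq_bigr (fun=> c)) ?prodr_const ?card_ord_lt// => j.
by rewrite inE => jm; rewrite ltnNge leq_sub2l.
Qed.

Lemma h_zero_root (R : realType) (n m : nat) (f : 'I_n -> R -> R)
    (phi : 'I_n -> 'rV[R]_n -> R) x : (0 < m)%N ->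
  (h_zero f phi m x `^ m%:R^-1) ^+ m = h_zero f phi m x.
Proof.
by move=> m0; apply: powR_invK => //; apply: prodr_ge0 => i _; exact: powR_ge0.
Qed.

(** The common factor [h_zero] is shared evenly between the [m] Hölder factors,
    each of which receives its [m]-th root. *)
Lemma mixed_integrand_prod (R : realType) (n m : nat) (f : 'I_n -> R -> R)
    (phi : 'I_n -> 'rV[R]_n -> R) : (0 < m <= n)%N ->
  mixed_integrand f phi =
  fun x => \prod_(j in [pred j : 'I_n | (j < m)%N])
    (h_zero f phi m x `^ m%:R^-1 * h_succ f phi j x).
Proof.
case/andP => m0 mn; apply/funext => x.
rewrite big_split/= prodr_const card_ord_lt// h_zero_root//.
exact: prod_split_last.
Qed.

(** Repeating the last function turns the product of distinct Hölder factors
    into the [m]-th power of a single one; the exponents [1/m] in the Hölder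
    factors are chosen for this. *)
Lemma mixed_integrand_repeat_last (R : realType) (n m : nat)
    (f : 'I_n -> R -> R) (phi : 'I_n -> 'rV[R]_n -> R) (j : 'I_n) :
  (m <= n)%N -> (j < m)%N ->
  mixed_integrand (repeat_last m (rev_ord j) f) (repeat_last m (rev_ord j) phi) =
  fun x => (h_zero f phi m x `^ m%:R^-1 * h_succ f phi j x) ^+ m.
Proof.
move=> mn jm; apply/funext => x.
rewrite exprMn h_zero_root ?(leq_ltn_trans _ jm)// -prod_repeat_last//.
by apply: eq_bigr => i _; rewrite /repeat_last; case: ifP.
Qed.

Theorem theorem4 (R : realType) (n : nat) (n_gt0 : (0 < n)%N)
  (f : 'I_n -> R -> R) (phi : 'I_n -> 'rV[R]_n -> R)
  (f_ge0 : forall i t, 0 <= f i t)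
  (f_conv : (forall i, convex_pos (f i)) \/ (forall i, concave_pos (f i)))
  (phi_lc : forall i, log_concave (phi i))
  (phi_reg : forall i, C2 (phi i) /\ L1 (phi i))
  (dual_reg : forall i, C2 (dual_fun (phi i)) /\ L1 (dual_fun (phi i)))
  (D_int : L1 (mixed_integrand f phi)) :
  (forall m : nat, (1 <= m <= n.-1)%N ->
    (forall k : 'I_n, (n - m <= k)%N ->
      L1 (mixed_integrand (repeat_last m k f) (repeat_last m k phi))) ->
    let g (j : 'I_n) (x : 'rV[R]_n) :=
      h_zero f phi m x `^ m%:R^-1 * h_succ f phi j x in
    mixed_divergence f phi ^+ m <=
      \prod_(k < n | (n - m <= k)%N)
        mixed_divergence (repeat_last m k f) (repeat_last m k phi) /\
    (mixed_divergence f phi ^+ m =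
      \prod_(k < n | (n - m <= k)%N)
        mixed_divergence (repeat_last m k f) (repeat_last m k phi) <->
     (exists j : 'I_n, (j < m)%N /\ null_ae (g j)) \/
     (forall i j : 'I_n, (i < m)%N -> (j < m)%N ->
       eff_proportional (g i) (g j))))
  /\
  ((forall k : 'I_n, L1 (div_integrand (f k) (phi k))) ->
    mixed_divergence f phi ^+ n <= \prod_(k < n) divergence (f k) (phi k) /\
    (mixed_divergence f phi ^+ n = \prod_(k < n) divergence (f k) (phi k) <->
     (exists j : 'I_n, null_ae (h_succ f phi j)) \/
     (forall i j : 'I_n,
       eff_proportional (h_succ f phi i) (h_succ f phi j)))).

Proof.
split=> [m /andP[m0 mn1] F_int g|F_int].
  have mn : (m <= n)%N by rewrite (leq_trans mn1)// leq_pred.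
  have m_bounds : (0 < m <= n)%N by rewrite m0.
  pose A := [pred j : 'I_n | (j < m)%N].
  have Am : #|A| = m by exact: card_ord_lt.
  have g0 j x : 0 <= g j x by rewrite mulr_ge0 ?powR_ge0.
  have gm j : j \in A ->
      (lebesgue_rV n).-integrable setT (EFin \o (fun x => g j x ^+ #|A|)).
    rewrite inE => jm; rewrite Am -mixed_integrand_repeat_last//.
    by apply: F_int; rewrite leq_sub2l.
  have gE := mixed_integrand_prod _ _ _ f phi m_bounds.
  have G_int : (lebesgue_rV n).-integrable setT
      (EFin \o (fun x => \prod_(j in A) g j x)) by rewrite -gE.
  have A0 : (0 < #|A|)%N by rewrite Am.
  have [] := holder_prod _ _ _ (lebesgue_rV n) _ A g A0 g0 gm G_int.
  have -> : \prod_(j in A) (\int[lebesgue_rV n]_x g j x ^+ #|A|)%R =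
      \prod_(k < n | (n - m <= k)%N)
        mixed_divergence (repeat_last m k f) (repeat_last m k phi).
    rewrite prod_rev_ord//; apply: eq_bigr => j; rewrite inE => jm.
    by rewrite /mixed_divergence mixed_integrand_repeat_last// Am.
  by rewrite Am /mixed_divergence gE => le eqE; split.
have gn k x : h_succ f phi k x ^+ n =
    div_integrand (f (rev_ord k)) (phi (rev_ord k)) x.
  by apply: powR_invK => //; exact: div_integrand_ge0.
have GE : mixed_integrand f phi = fun x => \prod_(k in 'I_n) h_succ f phi k x.
  apply/funext => x; rewrite /mixed_integrand [LHS](reindex_inj rev_ord_inj)/=.
  exact: eq_bigl.
have h0 k x : 0 <= h_succ f phi k x by exact: powR_ge0.
have hn k : k \in 'I_n -> (lebesgue_rV n).-integrable setT
    (EFin \o (fun x => h_succ f phi k x ^+ #|'I_n|)).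
  by move=> _; rewrite card_ord; under eq_fun do rewrite gn; exact: F_int.
have G_int : (lebesgue_rV n).-integrable setT
    (EFin \o (fun x => \prod_(k in 'I_n) h_succ f phi k x)) by rewrite -GE.
have A0 : (0 < #|'I_n|)%N by rewrite card_ord.
have [] := holder_prod _ _ _ (lebesgue_rV n) _ 'I_n _ A0 h0 hn G_int.
have -> : \prod_(k in 'I_n) (\int[lebesgue_rV n]_x h_succ f phi k x ^+ #|'I_n|)%R =
    \prod_(k < n) divergence (f k) (phi k).
  rewrite [RHS](reindex_inj rev_ord_inj)/=; apply: eq_bigr => k _.
  by rewrite card_ord; under eq_Rintegral do rewrite gn.
rewrite card_ord /mixed_divergence GE => le [eq1 eq2].
split; first exact: le.
split.
  by move=> /eq1[[k [_ k0]]|prop]; [left; exists k|right=> i j; exact: prop].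
move=> [[k k0]|prop]; apply: eq2; [left|right].
  by exists k; split=> //; exact: k0.
by move=> i j _ _; exact: prop.
Qed.
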